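(* Consider the indefinite linear least squares problem $x=\arg\min_u (b-Au)^tJ(b-Au)$, where $A\in\mathbb{R}^{m\times n}$, $m>n$, $b\in\mathbb{R}^m$, $J\in\mathbb{R}^{m\times m}$ is a diagonal matrix with only $\pm1$ on the diagonal, and $A^tJA$ is positive definite. Let $r=b-Ax$, and let $\|\mathbf{A}\|_F$ and $\|\mathbf{b}\|_2$ be the normalizing factors for perturbations $\Delta A$ of $A$ and $\Delta b$ of $b$. Let $\mathcal{M}_1,\mathcal{M}_2,\chi_x(A),\chi_x(b),\mathcal{B}$ be the quantities defined in the context. If $$\rho=\frac{\mathcal{B}+\chi_x(b)}{\chi_x(A)+\chi_x(b)},\qquad \lambda_1=\frac{\|\mathcal{M}_1\|_2+\|\mathcal{M}_2\|_2}{\|\mathcal{M}_1-\mathcal{M}_2\|_2},\qquad \lambda_2=\frac{\|\mathbf{A}\|_F\,\|x\|_2}{\|\mathbf{b}\|_2},$$ and no terms vanish, then $$2\rho\;\ge^{*}\;\lambda_1\;\ge\;\rho\qquad\text{and}\qquad \rho+\tfrac12\;\ge^{*}\;\lambda_2\;\ge\;\frac{\rho}{2}-1,$$ in which the unstarred inequalities $\lambda_1\ge\rho$ and $\lambda_2\ge\frac{\rho}{2}-1$ always hold, and at least one of the two inequalities marked $( * )$ is true, but not necessarily both. Consequently, the perturbation bound $$\frac{\|\Delta x\|_2}{\|x\|_2}\le \|\mathbf{A}\|_F\left(\|(A^tJA)^{-1}A^t\|_2+\|(A^tJA)^{-1}\|_2\,\frac{\|r\|_2}{\|x\|_2}\right)\epsilon+\frac{\|\mathbf{b}\|_2}{\|x\|_2}\,\|(A^tJA)^{-1}A^t\|_2\,\epsilon+O(\epsilon^2)$$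 (where $x+\Delta x$ is the solution for the data $A+\Delta A$, $b+\Delta b$, and $\epsilon$ is as in the context) is a uniformly large overestimate for all $\Delta A$ and $\Delta b$ if and only if both $\lambda_1$ and $\lambda_2$ are much larger than $1$, in which case the factor of overestimation is at least either $\lambda_1 2^{-1}$ or $\lambda_2-2^{-1}$.
   Context: Since $A^tJA$ is positive definite, the solution of the indefinite linear least squares problem is $x=(A^tJA)^{-1}A^tJb$. Here $\|\cdot\|_2$ is the Euclidean vector norm or the induced (spectral) matrix norm, $\|\cdot\|_F$ is the Frobenius norm, and $\otimes$ is the Kronecker product ($H\otimes K$ has blocks consisting of $K$ scaled by the corresponding entries of $H$). The normalizing factors $\|\mathbf{A}\|_F$ and $\|\mathbf{b}\|_2$ are chosen scale factors; the customary choice is $\mathbf{A}=A$, $\mathbf{b}=b$. Perturbations $\Delta A$, $\Delta b$ are measured by $$\epsilon=\max\left\{\frac{\|\Delta A\|_F}{\|\mathbf{A}\|_F},\frac{\|\Delta b\|_2}{\|\mathbf{b}\|_2}\right\},$$ and $(A+\Delta A)^tJ(A+\Delta A)$ is supposed to be positive definite. Definitions: $$\mathcal{M}_1=(A^tJA)^{-1}\otimes(Jr)^t,\qquad \mathcal{M}_2=x^t\otimes\big((A^tJA)^{-1}A^tJ\big),$$ with $\|\mathcal{M}_1\|_2=\|(A^tJA)^{-1}\|_2\,\|r\|_2$ and $\|\mathcal{M}_2\|_2=\|x\|_2\,\|(A^tJA)^{-1}A^t\|_2$, and $$\chi_x(A)=\frac{\|\mathbf{A}\|_F}{\|x\|_2}\,\|\mathcal{M}_1-\mathcal{M}_2\|_2,\qquad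 \mathcal{B}=\frac{\|\mathbf{A}\|_F}{\|x\|_2}\big(\|\mathcal{M}_1\|_2+\|\mathcal{M}_2\|_2\big),\qquad \chi_x(b)=\frac{\|\mathbf{b}\|_2\,\|\mathcal{M}_2\|_2}{\|x\|_2^2}.$$ The matrix $\mathcal{M}_1-\mathcal{M}_2$ is the Jacobian matrix of $x$ with respect to the entries of $A$ (stacked by columns), and $\chi_x(A)$, $\chi_x(b)$ are the condition numbers of $x$ with respect to $A$ and $b$ for the scaled norms. In this notation the perturbation bound in the claim is $\|\Delta x\|_2/\|x\|_2\le[\mathcal{B}+\chi_x(b)]\,\epsilon+O(\epsilon^2)$. The bound $\|\Delta x\|_2/\|x\|_2\le[\chi_x(A)+\chi_x(b)]\,\epsilon+O(\epsilon^2)$ also holds for all $\Delta A$, $\Delta b$, and its coefficient is at most twice the joint condition number of $x$ with respect to $(A,b)$, for which the corresponding bound can be approximately attained. Thus, apart from higher-order terms, the bound in the claim exceeds this smaller bound by the factor $\rho$, and so overestimates $\|\Delta x\|_2/\|x\|_2$ by at least that factor for all $\Delta A$ and $\Delta b$. *)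

(* Defs.v *)
From HB Require Import structures.
From mathcomp Require Import all_boot all_order all_algebra.
From mathcomp Require Import mxtens.
From mathcomp Require Import all_classical all_reals.
Set Implicit Arguments.
Unset Strict Implicit.
Unset Printing Implicit Defensive.
Import Order.TTheory GRing.Theory Num.Theory.
Local Open Scope classical_set_scope.
Local Open Scope ring_scope.

Definition norm2 (R : realType) (m : nat) (v : 'cV[R]_m) : R :=
  Num.sqrt (\sum_i v i 0 ^+ 2).

Definition normF (R : realType) (m n : nat) (M : 'M[R]_(m, n)) : R :=
  Num.sqrt (\sum_i \sum_j M i j ^+ 2).

(* The matrix norm induced by norm2.  The unit ball rather than the unit
   sphere, so that the set is nonempty in every dimension. *)
Definition normS (R : realType) (m n : nat) (M : 'M[R]_(m, n)) : R :=
  sup [set norm2 (M *m v) | v in [set v : 'cV[R]_n | norm2 v <= 1]].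

Definition posdef (R : realType) (n : nat) (M : 'M[R]_n) : Prop :=
  M^T = M /\ forall v : 'cV[R]_n, v != 0 -> 0 < (v^T *m M *m v) 0 0.

Definition signature_mx (R : realType) (m : nat) (J : 'M[R]_m) : Prop :=
  is_diag_mx J /\ forall i, J i i = 1 \/ J i i = -1.

Definition ils_objective (R : realType) (m n : nat) (A : 'M[R]_(m, n))
    (J : 'M[R]_m) (b : 'cV[R]_m) (u : 'cV[R]_n) : R :=
  ((b - A *m u)^T *m J *m (b - A *m u)) 0 0.

Definition ils_argmin (R : realType) (m n : nat) (A : 'M[R]_(m, n))
    (J : 'M[R]_m) (b : 'cV[R]_m) (x : 'cV[R]_n) : Prop :=
  forall u, ils_objective A J b x <= ils_objective A J b u.

(* [sclA] and [sclb] are the boldface A and b: only their norms matter, as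
   scale factors for the perturbations of [matA] and [rhs].  They need not be
   [matA] and [rhs] themselves. *)
Record ils_data (R : realType) (m n : nat) := IlsData {
  matA : 'M[R]_(m, n);
  sigJ : 'M[R]_m;
  rhs : 'cV[R]_m;
  sol : 'cV[R]_n;
  sclA : 'M[R]_(m, n);
  sclb : 'cV[R]_m }.

Section Quantities.
Variables (R : realType) (m n : nat) (P : ils_data R m n).
Local Notation A := (matA P).
Local Notation J := (sigJ P).
Local Notation b := (rhs P).
Local Notation x := (sol P).

Definition ils_problem : Prop :=
  [/\ (n < m)%N, signature_mx J, posdef (A^T *m J *m A) & ils_argmin A J b x].

Definition resid : 'cV[R]_m := b - A *m x.

Definition invG : 'M[R]_n := invmx (A^T *m J *m A).

(* The casts only identify the row dimensions n * 1 and 1 * n with n. *)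
Definition M1 : 'M[R]_(n, n * m) :=
  castmx (muln1 n, erefl (n * m)%N) (invG *t (J *m resid)^T).

Definition M2 : 'M[R]_(n, n * m) :=
  castmx (mul1n n, erefl (n * m)%N) (x^T *t (invG *m A^T *m J)).

Definition chiA : R := normF (sclA P) / norm2 x * normS (M1 - M2).

Definition calB : R := normF (sclA P) / norm2 x * (normS M1 + normS M2).

Definition chib : R := norm2 (sclb P) * normS M2 / norm2 x ^+ 2.

Definition rho : R := (calB + chib) / (chiA + chib).

Definition lambda1 : R := (normS M1 + normS M2) / normS (M1 - M2).

Definition lambda2 : R := normF (sclA P) * norm2 x / norm2 (sclb P).

Definition no_term_vanishes : Prop :=
  [/\ normF (sclA P) != 0, norm2 (sclb P) != 0 & norm2 x != 0] /\
  [/\ normS M1 != 0, normS M2 != 0 & normS (M1 - M2) != 0].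

Definition pert_eps (dA : 'M[R]_(m, n)) (db : 'cV[R]_m) : R :=
  Num.max (normF dA / normF (sclA P)) (norm2 db / norm2 (sclb P)).

Definition bound_coeff : R :=
  normF (sclA P) *
    (normS (invG *m A^T) + normS invG * (norm2 resid / norm2 x)) +
  norm2 (sclb P) / norm2 x * normS (invG *m A^T).

(* f * (|dx| / |x|) <= bound_coeff * eps + O(eps^2) for all perturbations
   dA, db, where the constant in O(eps^2) depends on P and f but not on the
   perturbation.  For f = 1 this is the perturbation bound itself; for general
   f it says that, apart from second-order terms, the bound overestimates
   |dx| / |x| by at least the factor f for all dA and db. *)
Definition overestimates_by (f : R) : Prop :=
  exists C delta : R, 0 < delta /\
    forall (dA : 'M[R]_(m, n)) (db : 'cV[R]_m) (dx : 'cV[R]_n),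
      posdef ((A + dA)^T *m J *m (A + dA)) ->
      ils_argmin (A + dA) J (b + db) (x + dx) ->
      pert_eps dA db <= delta ->
      f * (norm2 dx / norm2 x) <=
        bound_coeff * pert_eps dA db + C * pert_eps dA db ^+ 2.

Definition perturbation_bound : Prop := overestimates_by 1.

End Quantities.

(* Main.v *)
Require Import Defs.
From mathcomp Require Import all_boot all_order all_algebra.
From mathcomp Require Import ring lra mxtens.
From mathcomp Require Import all_classical all_reals.
Set Implicit Arguments.
Unset Strict Implicit.
Unset Printing Implicit Defensive.
Import Order.TTheory GRing.Theory Num.Theory.
Local Open Scope ring_scope.

(** The proof separates a first-order analysis of the perturbed problem from
elementary inequalities between the three norms [normS M1], [normS M2] and
[normS (M1 - M2)].

Subtracting the normal equations of the two problems gives the change of the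
solution as [response dA db] plus a remainder of order [eps ^ 2], where
[response] is linear, namely [M1 - M2] applied to the entries of [dA] plus
[G^-1 A^T J] applied to [db] ([solution_change], [response_error]).  Hence the
relative change is at most [(chiA + chib) * eps] to first order.  The coefficient
of the perturbation bound is [calB + chib = rho * (chiA + chib)]
([bound_coeffE], by the multiplicativity of the spectral norm on the Kronecker
products with a vector), so the bound overestimates by every factor up to [rho]
([overestimates_by_rho]); the bound itself is the case of the factor 1.
Conversely, [chiA] and [chib] are each approached by perturbing [A] alone or [b]
alone, so no factor above [2 * rho] is uniform ([overestimates_by_le_rho]).
That perturbations in every direction are admissible when small is the openness
of positive definiteness ([posdef_near], [perturbed_solution]).

It remains to compare [rho] with the two ratios [lambda1] and [lambda2].
Adding [chib] to both terms of the quotient [calB / chiA = lambda1 >= 1] moves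
it towards 1, and the result is [rho], which is thus below [lambda1]; the triangle
inequalities between the three norms give [rho <= 2 * lambda2 + 1]
and, depending on which of [chiA] and [chib] is the larger,
[lambda1 <= 2 * rho] or [lambda2 <= rho] ([lambda_le_rho]).  So [rho] is large
exactly when both ratios are.

For the failure of one starred inequality, [lambda1] does not depend on the scale
factors, whereas [lambda2] is proportional to [normF sclA]; making [lambda2]
exceed [lambda1 >= rho] by 1 is enough. *)

(** * Euclidean, Frobenius and spectral norms *)

Section EuclideanNorms.
Variable R : realType.
Implicit Types m n p : nat.

Lemma cauchy_schwarz (I : finType) (f g : I -> R) :
  (\sum_i f i * g i) ^+ 2 <= (\sum_i f i ^+ 2) * (\sum_i g i ^+ 2).
Proof.
set c := \sum_i f i * g i; set a := \sum_i f i ^+ 2; set b := \sum_i g i ^+ 2.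
have b_ge0 : 0 <= b by apply: sumr_ge0 => i _; exact: sqr_ge0.
have [b0|b_neq0] := eqVneq b 0.
  have g0 i : g i = 0.
    move/eqP: b0; rewrite psumr_eq0 => [/allP/(_ i)|j _]; last exact: sqr_ge0.
    by rewrite mem_index_enum sqrf_eq0 => /(_ isT)/eqP.
  rewrite /c big1 ?b0 ?mulr0 ?expr0n// => i _.
  by rewrite g0 mulr0.
have b_gt0 : 0 < b by rewrite lt_def b_neq0.
(* The vector b f - c g is, up to scale, the component of f orthogonal to g. *)
have : 0 <= \sum_i (b * f i - c * g i) ^+ 2.
  by apply: sumr_ge0 => i _; exact: sqr_ge0.
have -> : \sum_i (b * f i - c * g i) ^+ 2 = b * (a * b - c ^+ 2).
  have expand (s t : R) : \sum_i (s * f i - t * g i) ^+ 2 =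
      s ^+ 2 * a - (s * t) *+ 2 * c + t ^+ 2 * b.
    rewrite /a /b /c !mulr_sumr -sumrB -big_split /=.
    by apply: eq_bigr => i _; ring.
  by rewrite expand; ring.
by rewrite pmulr_rge0// subr_ge0.
Qed.

Definition dotF m n (M N : 'M[R]_(m, n)) : R := \sum_i \sum_j M i j * N i j.

Lemma normF_ge0 m n (M : 'M[R]_(m, n)) : 0 <= normF M.
Proof. exact: sqrtr_ge0. Qed.

Lemma normF_sqr m n (M : 'M[R]_(m, n)) : normF M ^+ 2 = \sum_i \sum_j M i j ^+ 2.
Proof.
by rewrite sqr_sqrtr//; do 2![apply: sumr_ge0 => ? _]; exact: sqr_ge0.
Qed.

Lemma norm2E m (v : 'cV[R]_m) : norm2 v = normF v.
Proof. by congr Num.sqrt; apply: eq_bigr => i _; rewrite big_ord1. Qed.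

Lemma normF_eq0 m n (M : 'M[R]_(m, n)) : (normF M == 0) = (M == 0).
Proof.
rewrite -sqrf_eq0 normF_sqr; apply/idP/eqP => [|->]; last first.
  by rewrite big1// => i _; rewrite big1// => j _; rewrite mxE expr0n.
rewrite pair_bigA/= psumr_eq0 => [/allP M0|? _]; last exact: sqr_ge0.
apply/matrixP => i j; rewrite mxE.
by have := M0 (i, j); rewrite mem_index_enum sqrf_eq0 => /(_ isT)/eqP.
Qed.

Lemma normF0 m n : normF (0 : 'M[R]_(m, n)) = 0.
Proof. by apply/eqP; rewrite normF_eq0. Qed.

Lemma normFZ m n (a : R) (M : 'M[R]_(m, n)) : normF (a *: M) = `|a| * normF M.
Proof.
apply/eqP; rewrite -(@eqrXn2 _ 2) ?mulr_ge0 ?normF_ge0//.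
rewrite exprMn !normF_sqr real_normK ?num_real// mulr_sumr; apply/eqP.
by apply: eq_bigr => i _; rewrite mulr_sumr; apply: eq_bigr => j _; rewrite mxE exprMn.
Qed.

Lemma normFN m n (M : 'M[R]_(m, n)) : normF (- M) = normF M.
Proof. by rewrite -scaleN1r normFZ normrN1 mul1r. Qed.

Lemma normF_tr m n (M : 'M[R]_(m, n)) : normF M^T = normF M.
Proof.
congr Num.sqrt; rewrite exchange_big/=.
by apply: eq_bigr => i _; apply: eq_bigr => j _; rewrite mxE.
Qed.

Lemma dotF_le m n (M N : 'M[R]_(m, n)) : dotF M N <= normF M * normF N.
Proof.
apply: (le_trans (ler_norm _)).
rewrite -ler_sqr ?nnegrE ?mulr_ge0 ?normF_ge0//.
rewrite real_normK ?num_real// exprMn !normF_sqr /dotF !pair_bigA/=.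
exact: cauchy_schwarz.
Qed.

Lemma normFD m n (M N : 'M[R]_(m, n)) : normF (M + N) <= normF M + normF N.
Proof.
rewrite -ler_sqr ?nnegrE ?addr_ge0 ?normF_ge0//.
have -> : normF (M + N) ^+ 2 = normF M ^+ 2 + dotF M N *+ 2 + normF N ^+ 2.
  rewrite !normF_sqr /dotF -sumrMnl -!big_split/=; apply: eq_bigr => i _.
  rewrite -sumrMnl -!big_split/=; apply: eq_bigr => j _.
  by rewrite mxE sqrrD.
by rewrite sqrrD lerD2r lerD2l lerMn2r dotF_le.
Qed.

Lemma normFB m n (M N : 'M[R]_(m, n)) : normF (M - N) <= normF M + normF N.
Proof. by rewrite -(normFN N) normFD. Qed.

Lemma normF_mul m n p (M : 'M[R]_(m, n)) (N : 'M[R]_(n, p)) :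
  normF (M *m N) <= normF M * normF N.
Proof.
rewrite -ler_sqr ?nnegrE ?mulr_ge0 ?normF_ge0// exprMn.
rewrite -(normF_tr N) !normF_sqr mulr_suml; apply: ler_sum => i _.
rewrite mulr_sumr; apply: ler_sum => j _; rewrite mxE.
under [X in _ <= _ * X]eq_bigr do rewrite mxE.
exact: cauchy_schwarz.
Qed.

Lemma norm2_ge0 m (v : 'cV[R]_m) : 0 <= norm2 v.
Proof. by rewrite norm2E normF_ge0. Qed.

Lemma norm2_eq0 m (v : 'cV[R]_m) : (norm2 v == 0) = (v == 0).
Proof. by rewrite norm2E normF_eq0. Qed.

Lemma norm2_gt0 m (v : 'cV[R]_m) : (0 < norm2 v) = (v != 0).
Proof. by rewrite lt_def norm2_ge0 andbT norm2_eq0. Qed.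

Lemma norm2_0 m : norm2 (0 : 'cV[R]_m) = 0.
Proof. by rewrite norm2E normF0. Qed.

Lemma norm2Z m (a : R) (v : 'cV[R]_m) : norm2 (a *: v) = `|a| * norm2 v.
Proof. by rewrite !norm2E normFZ. Qed.

Lemma norm2N m (v : 'cV[R]_m) : norm2 (- v) = norm2 v.
Proof. by rewrite !norm2E normFN. Qed.

Lemma norm2D m (v w : 'cV[R]_m) : norm2 (v + w) <= norm2 v + norm2 w.
Proof. by rewrite !norm2E normFD. Qed.

Lemma norm2_sqr m (v : 'cV[R]_m) : norm2 v ^+ 2 = (v^T *m v) 0 0.
Proof.
rewrite norm2E normF_sqr mxE; apply: eq_bigr => i _.
by rewrite big_ord1 !mxE expr2.
Qed.

Lemma norm2_normalize m (v : 'cV[R]_m) : v != 0 -> norm2 ((norm2 v)^-1 *: v) = 1.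
Proof.
by move=> v0; rewrite norm2Z ger0_norm ?invr_ge0 ?norm2_ge0// mulVf ?norm2_eq0.
Qed.

(** Without this, [sup] would take a default value; the Frobenius norm is a
bound. *)
Lemma normS_has_sup m n (M : 'M[R]_(m, n)) :
  has_sup [set norm2 (M *m v) | v in [set v : 'cV[R]_n | norm2 v <= 1]]%classic.
Proof.
split; first by exists (norm2 (M *m 0)), 0 => //=; rewrite norm2_0.
exists (normF M) => _ [v /= v1 <-]; rewrite norm2E (le_trans (normF_mul _ _))//.
by rewrite ler_piMr ?normF_ge0// -norm2E.
Qed.

Lemma normS_ge m n (M : 'M[R]_(m, n)) v : norm2 v <= 1 -> norm2 (M *m v) <= normS M.
Proof. by move=> v1; apply: (sup_upper_bound (normS_has_sup M)); exists v. Qed.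

Lemma normS_le m n (M : 'M[R]_(m, n)) K :
  (forall v, norm2 v <= 1 -> norm2 (M *m v) <= K) -> normS M <= K.
Proof.
move=> MK; apply: sup_le_ub; first by case: (normS_has_sup M).
by move=> _ [v /= v1 <-]; exact: MK.
Qed.

Lemma normS_ge0 m n (M : 'M[R]_(m, n)) : 0 <= normS M.
Proof.
by apply: le_trans (norm2_ge0 _) (@normS_ge _ _ M 0 _); rewrite norm2_0.
Qed.

Lemma norm2_mul m n (M : 'M[R]_(m, n)) v : norm2 (M *m v) <= normS M * norm2 v.
Proof.
have [->|v0] := eqVneq v 0; first by rewrite mulmx0 !norm2_0 mulr0.
have vgt0 : 0 < norm2 v by rewrite norm2_gt0.
rewrite -ler_pdivrMr// mulrC.
rewrite -(ger0_norm (ltW vgt0)) -normfV -norm2Z scalemxAr normS_ge//.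
by rewrite norm2_normalize.
Qed.

Lemma normS_le_mul m n (M : 'M[R]_(m, n)) K : 0 <= K ->
  (forall v, norm2 (M *m v) <= K * norm2 v) -> normS M <= K.
Proof.
move=> K0 MK; apply: normS_le => v v1.
by rewrite (le_trans (MK v))// ler_piMr.
Qed.

Lemma normS_eq0 m n (M : 'M[R]_(m, n)) : normS M = 0 -> M = 0.
Proof.
move=> M0; apply/matrixP => i j.
have := norm2_mul M (delta_mx j 0); rewrite M0 mul0r -colE.
rewrite le_eqVlt ltNge norm2_ge0 orbF norm2_eq0 => /eqP/matrixP/(_ i 0).
by rewrite !mxE.
Qed.

Lemma normSN m n (M : 'M[R]_(m, n)) : normS (- M) = normS M.
Proof.
have le (N : 'M[R]_(m, n)) : normS (- N) <= normS N.
  by apply: normS_le => v v1; rewrite mulNmx norm2N normS_ge.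
by apply/eqP; rewrite eq_le le -{1}(opprK M) le.
Qed.

Lemma normSD m n (M N : 'M[R]_(m, n)) : normS (M + N) <= normS M + normS N.
Proof.
apply: normS_le => v v1; rewrite mulmxDl (le_trans (norm2D _ _))//.
by rewrite lerD ?normS_ge.
Qed.

Lemma normSB m n (M N : 'M[R]_(m, n)) : normS (M - N) <= normS M + normS N.
Proof. by rewrite -(normSN N) normSD. Qed.

End EuclideanNorms.

(** * Kronecker products with a vector *)

Section Vectorization.
Variable R : realType.
Implicit Types m n p : nat.

(** The entries are stacked by columns: the column index of [X] is the major
one. *)
Definition vecmx m n (X : 'M[R]_(m, n)) : 'cV[R]_(n * m) :=
  \col_k X (mxtens_unindex k).2 (mxtens_unindex k).1.

Lemma vecmx_surj m n (v : 'cV[R]_(n * m)) : exists X : 'M[R]_(m, n), v = vecmx X.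
Proof.
exists (\matrix_(i, j) v (mxtens_index (j, i)) 0); apply/colP => k.
by rewrite !mxE -surjective_pairing mxtens_unindexK.
Qed.

Lemma sum_mxtens n m (F : 'I_n -> 'I_m -> R) :
  \sum_(k < n * m) F (mxtens_unindex k).1 (mxtens_unindex k).2 =
  \sum_j \sum_i F j i.
Proof.
rewrite pair_bigA/= (reindex (@mxtens_unindex n m))//.
exists (@mxtens_index n m) => k _; first exact: mxtens_unindexK.
exact: mxtens_indexK.
Qed.

Lemma norm2_vecmx m n (X : 'M[R]_(m, n)) : norm2 (vecmx X) = normF X.
Proof.
congr Num.sqrt; rewrite exchange_big/= -sum_mxtens.
by apply: eq_bigr => k _; rewrite mxE.
Qed.

Lemma tens_row_vecmx m n p (H : 'M[R]_(p, n)) (w : 'cV[R]_m) (X : 'M[R]_(m, n)) :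
  castmx (muln1 p, erefl (n * m)%N) (H *t w^T) *m vecmx X = H *m (X^T *m w).
Proof.
apply/colP => k; rewrite mxE.
have kE : (mxtens_unindex (cast_ord (esym (muln1 p)) k)).1 = k.
  by apply: val_inj; rewrite /= divn1.
under eq_bigr do rewrite castmxE cast_ord_id !mxE kE ord1.
rewrite (sum_mxtens (fun j i => H k j * w i 0 * X i j)) mxE.
apply: eq_bigr => j _; rewrite mxE mulr_sumr; apply: eq_bigr => i _.
by rewrite mxE mulrA mulrAC.
Qed.

Lemma row_tens_vecmx m n p (y : 'cV[R]_n) (K : 'M[R]_(p, m)) (X : 'M[R]_(m, n)) :
  castmx (mul1n p, erefl (n * m)%N) (y^T *t K) *m vecmx X = K *m (X *m y).
Proof.
apply/colP => k; rewrite mxE.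
have kE : (mxtens_unindex (cast_ord (esym (mul1n p)) k)).2 = k.
  by apply: val_inj; rewrite /= modn_small.
under eq_bigr do rewrite castmxE cast_ord_id !mxE kE ord1.
rewrite (sum_mxtens (fun j i => y j 0 * K k i * X i j)) mxE exchange_big/=.
apply: eq_bigr => i _; rewrite mxE mulr_sumr; apply: eq_bigr => j _.
by ring.
Qed.

Lemma normF_outer m n (v : 'cV[R]_m) (w : 'cV[R]_n) :
  normF (v *m w^T) <= norm2 v * norm2 w.
Proof. by rewrite (le_trans (normF_mul _ _))// normF_tr !norm2E. Qed.

Lemma outer_mul m n (v : 'cV[R]_m) (w : 'cV[R]_n) :
  v *m w^T *m w = norm2 w ^+ 2 *: v.
Proof.
by rewrite -mulmxA [w^T *m w]mx11_scalar -norm2_sqr mul_mx_scalar.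
Qed.

(** For a vector [u] of the unit ball, the rank-one matrix [u w^T / norm2 w]
is in the unit ball of the Frobenius norm and maps [w] to [norm2 w] times [u]; so
the Frobenius unit ball sends [w] onto the whole ball of radius [norm2 w]. *)
Lemma normS_rank_one m n p (K : 'M[R]_(p, m)) (w : 'cV[R]_n) (c : R) :
  (forall X : 'M[R]_(m, n), normF X <= 1 -> norm2 (K *m (X *m w)) <= c) ->
  normS K * norm2 w <= c.
Proof.
move=> Kc; have [->|w0] := eqVneq w 0.
  by have := Kc 0; rewrite normF0 mul0mx mulmx0 !norm2_0 mulr0; apply.
have wgt0 : 0 < norm2 w by rewrite norm2_gt0.
rewrite -ler_pdivlMr//; apply: normS_le => u u1; rewrite ler_pdivlMr//.
have := Kc ((norm2 w)^-1 *: (u *m w^T)).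
rewrite -scalemxAl outer_mul scalerA expr2 mulKf ?gt_eqF// -scalemxAr norm2Z.
rewrite gtr0_norm// mulrC; apply; rewrite normFZ normfV gtr0_norm//.
by rewrite mulrC ler_pdivrMr// (le_trans (normF_outer _ _))// ler_pM2r.
Qed.

Lemma normS_tens_row m n p (H : 'M[R]_(p, n)) (w : 'cV[R]_m) :
  normS (castmx (muln1 p, erefl (n * m)%N) (H *t w^T)) = normS H * norm2 w.
Proof.
apply/eqP; rewrite eq_le; apply/andP; split.
  apply: normS_le_mul => [|v]; first by rewrite mulr_ge0 ?normS_ge0 ?norm2_ge0.
  have [X ->] := vecmx_surj v; rewrite tens_row_vecmx norm2_vecmx.
  rewrite (le_trans (norm2_mul _ _))// -mulrA ler_wpM2l ?normS_ge0//.
  by rewrite !norm2E mulrC (le_trans (normF_mul _ _))// normF_tr.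
apply: (@normS_rank_one n m p) => X X1.
by rewrite -(trmxK X) -tens_row_vecmx normS_ge// norm2_vecmx normF_tr.
Qed.

Lemma normS_row_tens m n p (y : 'cV[R]_n) (K : 'M[R]_(p, m)) :
  normS (castmx (mul1n p, erefl (n * m)%N) (y^T *t K)) = norm2 y * normS K.
Proof.
apply/eqP; rewrite eq_le; apply/andP; split.
  apply: normS_le_mul => [|v]; first by rewrite mulr_ge0 ?normS_ge0 ?norm2_ge0.
  have [X ->] := vecmx_surj v; rewrite row_tens_vecmx norm2_vecmx.
  rewrite (le_trans (norm2_mul _ _))// [norm2 y * _]mulrC -mulrA.
  rewrite ler_wpM2l ?normS_ge0// !norm2E mulrC.
  exact: normF_mul.
rewrite mulrC; apply: (@normS_rank_one m n p) => X X1.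
by rewrite -row_tens_vecmx normS_ge// norm2_vecmx.
Qed.

End Vectorization.

(** * Signature matrices and positive definite matrices *)

Section Signature.
Variables (R : realType) (m : nat) (J : 'M[R]_m).
Hypothesis sgJ : signature_mx J.

Lemma signature_tr : J^T = J.
Proof. by have [/diag_mxP [d ->] _] := sgJ; rewrite tr_diag_mx. Qed.

Lemma signature_sqr : J *m J = 1%:M.
Proof.
have [/diag_mxP [d Jd] J1] := sgJ; rewrite Jd mulmx_diag.
rewrite -diag_const_mx; congr diag_mx; apply/rowP => i.
have := J1 i; rewrite !mxE Jd mxE eqxx mulr1n.
by case=> ->; rewrite ?mulrNN mulr1.
Qed.

Lemma norm2_signature (v : 'cV[R]_m) : norm2 (J *m v) = norm2 v.
Proof.
apply/eqP; rewrite -(@eqrXn2 _ 2) ?norm2_ge0// !norm2_sqr trmx_mul signature_tr.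
by rewrite -mulmxA (mulmxA J) signature_sqr mul1mx.
Qed.

Lemma normS_mul_signature p (K : 'M[R]_(p, m)) : normS (K *m J) = normS K.
Proof.
have le (H : 'M[R]_(p, m)) : normS (H *m J) <= normS H.
  by apply: normS_le => v v1; rewrite -mulmxA normS_ge// norm2_signature.
apply/eqP; rewrite eq_le le -{1}[K]mulmx1 -signature_sqr mulmxA.
exact: le.
Qed.

End Signature.

Section PositiveDefinite.
Variables (R : realType) (n : nat).
Implicit Types (G H : 'M[R]_n) (u v : 'cV[R]_n).

Definition qform G v : R := (v^T *m G *m v) 0 0.

Lemma trmx11E (X : 'M[R]_1) : X^T 0 0 = X 0 0.
Proof. by rewrite mxE. Qed.

Lemma qformDl G H v : qform (G + H) v = qform G v + qform H v.
Proof. by rewrite /qform mulmxDr mulmxDl mxE. Qed.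

Lemma qform_sub_scale G u v (s : R) : G^T = G ->
  qform G (s *: v - u) =
  s ^+ 2 * qform G v - 2 * s * (v^T *m (G *m u)) 0 0 + qform G u.
Proof.
move=> symG; have swap : (u^T *m G *m v) 0 0 = (v^T *m G *m u) 0 0.
  by rewrite -[LHS]trmx11E !trmx_mul trmxK symG mulmxA.
move: swap; rewrite /qform mulmxA.
have -> : (s *: v - u)^T = s *: v^T - u^T by rewrite linearB/= linearZ.
rewrite !(mulmxBl, mulmxBr) -!(scalemxAl, scalemxAr).
move: (v^T *m G *m v) (u^T *m G *m v) (v^T *m G *m u) (u^T *m G *m u).
by move=> a b c d; rewrite !mxE => ->; ring.
Qed.

Lemma qform_le H v : qform H v <= normF H * norm2 v ^+ 2.
Proof.
rewrite /qform -mulmxA (le_trans (ler_norm _))//.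
have -> : `|(v^T *m (H *m v)) 0 0| = normF (v^T *m (H *m v)).
  by rewrite /normF !big_ord1 sqrtr_sqr.
rewrite (le_trans (normF_mul _ _))// normF_tr expr2 mulrCA !norm2E.
by rewrite ler_wpM2l ?normF_ge0 ?normF_mul.
Qed.

Lemma qformN H v : qform (- H) v = - qform H v.
Proof. by rewrite /qform mulmxN mulNmx mxE. Qed.

Lemma posdef_unit G : posdef G -> G \in unitmx.
Proof.
move=> [_ posG]; rewrite unitmxE unitfE; apply/negP => /det0P [w w0 wG0].
have := posG w^T; rewrite trmxK wG0 mul0mx mxE ltxx => /(_ _)/negP; apply=> //.
by rewrite trmx_eq0.
Qed.

Lemma posdef_ge0 G v : posdef G -> 0 <= qform G v.
Proof.
move=> [_ posG]; have [->|v0] := eqVneq v 0; last exact/ltW/posG.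
by rewrite /qform mulmx0 mxE.
Qed.

(** Positivity of the form at [K v - G^-1 v], with
[K] a bound of the form of [G^-1], gives [K ^ 2 v^T G v >= K v^T v]. *)
Lemma posdef_coercive G : posdef G ->
  exists2 c : R, 0 < c & forall v, c * norm2 v ^+ 2 <= qform G v.
Proof.
move=> posG; have unitG := posdef_unit posG; have symG := posG.1.
pose K := normF (invmx G) + 1.
have Kgt0 : 0 < K by rewrite ltr_wpDl ?normF_ge0.
exists K^-1; first by rewrite invr_gt0.
move=> v; have := posdef_ge0 (K *: v - invmx G *m v) posG.
rewrite qform_sub_scale// mulKVmx// -norm2_sqr.
have -> : qform G (invmx G *m v) = qform (invmx G) v.
  by rewrite /qform trmx_mul trmx_inv symG -!mulmxA mulKVmx.
have : qform (invmx G) v <= K * norm2 v ^+ 2.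
  by rewrite (le_trans (qform_le _ _))// ler_wpM2r ?sqr_ge0// lerDl.
move=> le1 le2; rewrite mulrC ler_pdivrMr//.
rewrite -(ler_pM2l Kgt0); move: le1 le2; move: (norm2 v ^+ 2) (qform _ _) (qform _ _).
by move=> N q p le1 le2; nra.
Qed.

Lemma posdef_near G : posdef G ->
  exists2 c : R, 0 < c &
    forall H, H^T = H -> normF (H - G) < c -> posdef H.
Proof.
move=> posG; have [c c0 cG] := posdef_coercive posG.
exists c => // H symH HG; split => // v v0.
have := cG v; have := qform_le (G - H) v.
rewrite -/(qform H v) qformDl qformN -normFN opprB.
have : normF (H - G) * norm2 v ^+ 2 < c * norm2 v ^+ 2.
  by rewrite ltr_pM2r// exprn_gt0// norm2_gt0.
lra.
Qed.

End PositiveDefinite.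

(** * Normal equations *)

Section NormalEquations.
Variables (R : realType) (m n : nat) (A : 'M[R]_(m, n)) (J : 'M[R]_m).
Hypotheses (sgJ : signature_mx J) (posG : posdef (A^T *m J *m A)).
Local Notation G := (A^T *m J *m A).

Lemma ils_objectiveD (b : 'cV[R]_m) (x h : 'cV[R]_n) :
  ils_objective A J b (x + h) =
  ils_objective A J b x - 2 * (h^T *m (A^T *m J *m (b - A *m x))) 0 0 + qform G h.
Proof.
rewrite /ils_objective (mulmxDr A) opprD addrA; set r := b - _.
have swap : (r^T *m J *m (A *m h)) 0 0 = (h^T *m (A^T *m J *m r)) 0 0.
  by rewrite -[LHS]trmx11E !trmx_mul trmxK (signature_tr sgJ) !mulmxA.
have -> : qform G h = ((A *m h)^T *m J *m (A *m h)) 0 0.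
  by rewrite /qform trmx_mul !mulmxA.
have eqh : (A *m h)^T *m J *m r = h^T *m (A^T *m J *m r).
  by rewrite trmx_mul !mulmxA.
have -> : (r - A *m h)^T = r^T - (A *m h)^T by rewrite linearB.
move: swap; rewrite -eqh !(mulmxBl, mulmxBr).
move: (r^T *m J *m r) (r^T *m J *m (A *m h)) ((A *m h)^T *m J *m r) (_ *m _ *m _).
by move=> x1 x2 x3 x4; rewrite !mxE => ->; ring.
Qed.

Lemma normal_equations_argmin (b : 'cV[R]_m) (x : 'cV[R]_n) :
  A^T *m J *m (b - A *m x) = 0 -> ils_argmin A J b x.
Proof.
move=> r0 u; rewrite -[u](subrKC x) ils_objectiveD r0 mulmx0 mxE mulr0 subr0.
by rewrite lerDl posdef_ge0.
Qed.

(** With [g] the residual of the normal equations, moving by the Newton step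
[h = G^-1 g] changes the objective by [- h^T G h], which is negative unless
[h = 0], that is, unless [g = 0]. *)
Lemma argmin_normal_equations (b : 'cV[R]_m) (x : 'cV[R]_n) :
  ils_argmin A J b x -> A^T *m J *m (b - A *m x) = 0.
Proof.
set g := _ *m _ => min_x; have unitG := posdef_unit posG.
pose h := invmx G *m g; have gE : g = G *m h by rewrite mulKVmx.
have := min_x (x + h); rewrite ils_objectiveD -/g gE mulmxA -/(qform G h).
have [h0|h_neq0] := eqVneq h 0; first by rewrite h0 mulmx0.
have : 0 < qform G h by apply: posG.2.
by move=> {gE} pos le; exfalso; lra.
Qed.

End NormalEquations.

(** * First-order perturbation theory *)

Section FirstOrder.
Variables (R : realType) (m n : nat) (P : ils_data R m n).
Local Notation A := (matA P).
Local Notation J := (sigJ P).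
Local Notation b := (rhs P).
Local Notation x := (sol P).
Local Notation r := (resid P).
Local Notation G := (A^T *m J *m A).
Local Notation pertG dA := ((A + dA)^T *m J *m (A + dA)).

(** The derivative of the solution with respect to the data, in the direction
[(dA, db)]. *)
Definition response (dA : 'M[R]_(m, n)) (db : 'cV[R]_m) : 'cV[R]_n :=
  invG P *m (dA^T *m (J *m r) + A^T *m J *m (db - dA *m x)).

Lemma responseE dA db :
  response dA db =
  (M1 P - M2 P) *m vecmx dA + invG P *m A^T *m J *m db.
Proof.
rewrite mulmxBl /M1 /M2 tens_row_vecmx row_tens_vecmx /response.
rewrite mulmxDr mulmxBr mulmxBr !mulmxA -addrA; congr (_ + _).
by rewrite mulmxBr mulmxA addrC.
Qed.

Lemma responseZ (t : R) dA db : response (t *: dA) (t *: db) = t *: response dA db.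
Proof.
rewrite /response scalemxAr; congr (_ *m _).
rewrite linearZ/= -!scalemxAl -scalerBr -scalemxAr -scalerDr.
by [].
Qed.

Lemma gram_diff dA :
  pertG dA - G = dA^T *m J *m A + A^T *m J *m dA + dA^T *m J *m dA.
Proof.
have -> : (A + dA)^T = A^T + dA^T by rewrite linearD.
rewrite !(mulmxDl, mulmxDr).
move: (A^T *m J *m A) (dA^T *m J *m A) (A^T *m J *m dA) (dA^T *m J *m dA).
by move=> g1 g2 g3 g4; rewrite -[g1 + g2 + _]addrA -[g1 + _]addrC addrK addrA.
Qed.

Lemma normF_mul_le p q s (M : 'M[R]_(p, q)) (N : 'M[R]_(q, s)) (c d : R) :
  normF M <= c -> normF N <= d -> normF (M *m N) <= c * d.
Proof.
by move=> Mc Nd; rewrite (le_trans (normF_mul _ _))// ler_pM ?normF_ge0.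
Qed.

Lemma normF_gram_diff dA :
  normF (pertG dA - G) <= normF dA * (normF J * (2 * normF A + normF dA)).
Proof.
rewrite gram_diff (le_trans (normFD _ _))//.
rewrite (le_trans (lerD (normFD _ _) (lexx _)))//.
have le3 p q s l (X : 'M[R]_(p, q)) (Y : 'M[R]_(q, s)) (Z : 'M[R]_(s, l)) :
    normF (X *m Y *m Z) <= normF X * normF Y * normF Z.
  by rewrite normF_mul_le ?normF_mul.
have := le3 _ _ _ _ dA^T J A; have := le3 _ _ _ _ A^T J dA.
have := le3 _ _ _ _ dA^T J dA; rewrite !normF_tr; lra.
Qed.

Hypothesis ilsP : ils_problem P.

Lemma ils_sgJ : signature_mx J. Proof. by case: ilsP. Qed.
Lemma ils_posG : posdef G. Proof. by case: ilsP. Qed.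
Lemma ils_normal_eq : A^T *m J *m r = 0.
Proof. by apply: argmin_normal_equations; case: ilsP. Qed.

Lemma gram_unit : G \in unitmx.
Proof. exact: posdef_unit ils_posG. Qed.

Lemma pert_gram_sym dA : (pertG dA)^T = pertG dA.
Proof. by rewrite !trmx_mul trmxK (signature_tr ils_sgJ) mulmxA. Qed.

Lemma normS_M1 : normS (M1 P) = normS (invG P) * norm2 r.
Proof. by rewrite /M1 normS_tens_row norm2_signature//; exact: ils_sgJ. Qed.

Lemma normS_M2 : normS (M2 P) = norm2 x * normS (invG P *m A^T).
Proof. by rewrite /M2 normS_row_tens normS_mul_signature//; exact: ils_sgJ. Qed.

(** An exact identity: the normal equations of the perturbed problem minus those
of the original one, solved for [G dx]. *)
Lemma solution_change dA db dx :
  posdef (pertG dA) -> ils_argmin (A + dA) J (b + db) (x + dx) ->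
  dx = response dA db +
       invG P *m (dA^T *m J *m (db - dA *m x) - (pertG dA - G) *m dx).
Proof.
move=> posG' /(argmin_normal_equations ils_sgJ posG').
have -> : b + db - (A + dA) *m (x + dx) = r + (db - dA *m x) - (A + dA) *m dx.
  rewrite /resid mulmxDr mulmxDl opprD addrA; congr (_ - _).
  by rewrite opprD addrACA.
rewrite mulmxBr mulmxA => /eqP; rewrite subr_eq0 => /eqP eqG'.
have expand (s t : 'cV[R]_m) : (A + dA)^T *m J *m (s + t) =
    A^T *m J *m s + A^T *m J *m t + (dA^T *m J *m s + dA^T *m J *m t).
  have -> : (A + dA)^T = A^T + dA^T by rewrite linearD.
  by rewrite !mulmxDl !mulmxDr.
rewrite /response -mulmxDr mulmxBl -eqG' expand ils_normal_eq add0r mulmxA.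
have cancel (u v w z : 'cV[R]_n) : u + v + (w - (v + (u + w) - z)) = z.
  by apply/colP => i; rewrite !mxE; ring.
rewrite cancel mulKmx//; exact: gram_unit.
Qed.

Lemma perturbed_solution dA db : exists2 d : R, 0 < d &
  forall t : R, 0 < t < d -> exists dx,
    posdef (pertG (t *: dA)) /\ ils_argmin (A + t *: dA) J (b + t *: db) (x + dx).
Proof.
have [c c0 cG] := posdef_near ils_posG.
pose e := normF dA; pose K := e * (normF J * (2 * normF A + e)).
have e0 : 0 <= e by exact: normF_ge0.
have K0 : 0 <= K by rewrite !mulr_ge0 ?addr_ge0 ?mulr_ge0 ?normF_ge0.
exists (Num.min 1 (c / (K + 1))).
  by rewrite lt_min ltr01 divr_gt0// ltr_wpDl.
move=> t /andP[t0]; rewrite lt_min => /andP[t1].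
rewrite ltr_pdivlMr ?ltr_wpDl// => tK.
have posG' : posdef (pertG (t *: dA)).
  apply: cG; first exact: pert_gram_sym.
  rewrite (le_lt_trans (normF_gram_diff _))// normFZ gtr0_norm// -/e.
  apply: le_lt_trans tK; apply: (@le_trans _ _ (t * K)).
    rewrite -mulrA !ler_wpM2l ?(ltW t0) ?normF_ge0// lerD2l.
    by rewrite ler_piMl// ltW.
  by rewrite ler_wpM2l ?(ltW t0)// lerDl.
exists (invmx (pertG (t *: dA)) *m ((A + t *: dA)^T *m J *m (b + t *: db)) - x).
split => //; apply: normal_equations_argmin => //; first exact: ils_sgJ.
rewrite subrKC mulmxBr [X in _ - X]mulmxA mulKVmx ?subrr//.
exact: posdef_unit posG'.
Qed.

(** The change of the solution satisfies a linear equation with the unperturbed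
Gram matrix in which the change [dx] reappears on the right with a coefficient
of order [eps]; for small [eps] this term is absorbed on the left, which avoids
bounding the inverse of the perturbed Gram matrix. *)
Lemma response_error : normF (sclA P) != 0 -> norm2 (sclb P) != 0 ->
  exists C delta : R, 0 < delta /\ forall dA db dx,
    posdef (pertG dA) -> ils_argmin (A + dA) J (b + db) (x + dx) ->
    pert_eps P dA db <= delta ->
    norm2 (dx - response dA db) <= C * pert_eps P dA db ^+ 2.
Proof.
set a := normF (sclA P); set be := norm2 (sclb P) => a_neq0 be_neq0.
have a_gt0 : 0 < a by rewrite lt_def a_neq0 normF_ge0.
have be_gt0 : 0 < be by rewrite lt_def be_neq0 norm2_ge0.
have [a_ge0 be_ge0] := (ltW a_gt0, ltW be_gt0).
pose g := normF (invG P); pose kJ := normF J; pose kA := normF A.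
pose kr := normF r; pose kx := normF x.
have g_ge0 : 0 <= g by exact: normF_ge0.
have kJ_ge0 : 0 <= kJ by exact: normF_ge0.
have kA_ge0 : 0 <= kA by exact: normF_ge0.
have kr_ge0 : 0 <= kr by exact: normF_ge0.
have kx_ge0 : 0 <= kx by exact: normF_ge0.
(* With E = eps <= 1, the change of the Gram matrix is at most c E, and the
   right-hand side changes by at most c1 E to first and c2 E^2 to second order. *)
pose c := a * (kJ * (2 * kA + a)).
pose c1 := a * (kJ * kr) + kA * kJ * (be + a * kx).
pose c2 := a * kJ * (be + a * kx).
have c_ge0 : 0 <= c by rewrite !(mulr_ge0, addr_ge0).
have c1_ge0 : 0 <= c1 by rewrite !(mulr_ge0, addr_ge0).
have c2_ge0 : 0 <= c2 by rewrite !(mulr_ge0, addr_ge0).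
have gc_gt0 : 0 < 2 * (g * c) + 1.
  by apply: ltr_wpDl; [apply: mulr_ge0 => //; exact: mulr_ge0|exact: ltr01].
exists (g * (c2 + c * (2 * (g * (c1 + c2))))), (Num.min 1 (2 * (g * c) + 1)^-1).
split; first by rewrite lt_min ltr01 invr_gt0.
move=> dA db dx posG' min_dx; set E := pert_eps P dA db; rewrite le_min => /andP[E1].
rewrite -[_^-1]mul1r ler_pdivlMr// => Egc.
have dA_le : normF dA <= E * a by rewrite -ler_pdivrMr// le_max lexx.
have db_le : normF db <= E * be by rewrite -norm2E -ler_pdivrMr// le_max lexx orbT.
have E_ge0 : 0 <= E by rewrite le_max divr_ge0 ?normF_ge0.
have e_le : normF (db - dA *m x) <= E * (be + a * kx).
  rewrite (le_trans (normFB _ _))// mulrDr mulrA lerD//.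
  exact: normF_mul_le.
have g1_le : normF (response dA db) <= g * (E * c1).
  apply: normF_mul_le => //; rewrite (le_trans (normFD _ _))// mulrDr lerD//.
    by rewrite mulrA; apply: normF_mul_le; rewrite ?normF_tr ?normF_mul.
  rewrite mulrCA; apply: normF_mul_le => //.
  by apply: normF_mul_le; rewrite ?normF_tr.
have g2_le : normF (dA^T *m J *m (db - dA *m x)) <= E * a * kJ * (E * (be + a * kx)).
  by do 2!apply: normF_mul_le => //; rewrite normF_tr.
have dG_le : normF (pertG dA - G) <= E * c.
  rewrite (le_trans (normF_gram_diff _))// /c [leRHS]mulrA ler_pM//;
    do ?[by rewrite !(mulr_ge0, addr_ge0, normF_ge0)].
  rewrite ler_wpM2l// lerD2l (le_trans dA_le)//.
  by rewrite ler_piMl ?(ltW a_gt0).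
have dxE := solution_change posG' min_dx.
have rest_le : norm2 (dx - response dA db) <=
    g * (E ^+ 2 * c2 + E * c * normF dx).
  rewrite {1}dxE addrC addKr norm2E; apply: normF_mul_le => //.
  rewrite (le_trans (normFB _ _))// lerD//; last exact: normF_mul_le.
  by rewrite (le_trans g2_le)// /c2 le_eqVlt; apply/orP; left; apply/eqP; ring.
have dx_le : normF dx <= 2 * (g * (c1 + c2)) * E.
  have : normF dx <= norm2 (dx - response dA db) + normF (response dA db).
    by rewrite norm2E -{1}(subrK (response dA db) dx) normFD.
  have : 0 <= normF dx by exact: normF_ge0.
  move: (normF dx) rest_le g1_le => u rest_le g1_le u_ge0 u_le.
  have E2 : E ^+ 2 * c2 <= E * c2 by rewrite ler_wpM2r// expr2 ler_piMl.
  have gE2 : g * (E ^+ 2 * c2) <= g * (E * c2) by rewrite ler_wpM2l.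
  have absorb : 2 * (g * (E * c * u)) <= u.
    have := ler_wpM2r u_ge0 Egc; have := mulr_ge0 E_ge0 u_ge0; nra.
  by move: rest_le; rewrite mulrDr; lra.
apply: (le_trans rest_le).
rewrite [leRHS](_ : _ = g * (E ^+ 2 * c2 + E * c * (2 * (g * (c1 + c2)) * E))).
  by rewrite ler_wpM2l// lerD2l ler_wpM2l// mulr_ge0.
by ring.
Qed.

End FirstOrder.

(** * Condition numbers and overestimation factors *)

Section Overestimation.
Variables (R : realType) (m n : nat) (P : ils_data R m n).
Hypotheses (ilsP : ils_problem P) (nzP : no_term_vanishes P).
Local Notation A := (matA P).
Local Notation J := (sigJ P).
Local Notation b := (rhs P).
Local Notation x := (sol P).

Lemma sclA_gt0 : 0 < normF (sclA P).
Proof. by case: nzP => -[nz _ _] _; rewrite lt_def nz normF_ge0. Qed.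

Lemma sclb_gt0 : 0 < norm2 (sclb P).
Proof. by case: nzP => -[_ nz _] _; rewrite lt_def nz norm2_ge0. Qed.

Lemma sol_gt0 : 0 < norm2 x.
Proof. by case: nzP => -[_ _ nz] _; rewrite lt_def nz norm2_ge0. Qed.

Lemma M1_gt0 : 0 < normS (M1 P).
Proof. by case: nzP => _ [nz _ _]; rewrite lt_def nz normS_ge0. Qed.

Lemma M2_gt0 : 0 < normS (M2 P).
Proof. by case: nzP => _ [_ nz _]; rewrite lt_def nz normS_ge0. Qed.

Lemma M12_gt0 : 0 < normS (M1 P - M2 P).
Proof. by case: nzP => _ [_ _ nz]; rewrite lt_def nz normS_ge0. Qed.

Lemma M12_le : normS (M1 P - M2 P) <= normS (M1 P) + normS (M2 P).
Proof. exact: normSB. Qed.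

Lemma M1_le : normS (M1 P) <= normS (M1 P - M2 P) + normS (M2 P).
Proof. by rewrite -{1}(subrK (M2 P) (M1 P)) normSD. Qed.

Lemma M2_le : normS (M2 P) <= normS (M1 P) + normS (M1 P - M2 P).
Proof. by rewrite -{1}(subKr (M1 P) (M2 P)) normSB. Qed.

Lemma relA_gt0 : 0 < normF (sclA P) / norm2 x.
Proof. by rewrite divr_gt0 ?sclA_gt0 ?sol_gt0. Qed.

Lemma chiA_gt0 : 0 < chiA P.
Proof. by rewrite mulr_gt0 ?relA_gt0 ?M12_gt0. Qed.

Lemma chib_gt0 : 0 < chib P.
Proof. by rewrite divr_gt0 ?mulr_gt0 ?exprn_gt0 ?sclb_gt0 ?M2_gt0 ?sol_gt0. Qed.

Lemma chi_gt0 : 0 < chiA P + chib P.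
Proof. by rewrite addr_gt0 ?chiA_gt0 ?chib_gt0. Qed.

Lemma chib_lambda2 : chib P * lambda2 P = normF (sclA P) / norm2 x * normS (M2 P).
Proof.
by rewrite /chib /lambda2; field; rewrite !gt_eqF ?sclb_gt0 ?sol_gt0.
Qed.

Lemma rho_chi : rho P * (chiA P + chib P) = calB P + chib P.
Proof. by rewrite divfK// gt_eqF ?chi_gt0. Qed.

Lemma rho_ge1 : 1 <= rho P.
Proof.
rewrite ler_pdivlMr ?chi_gt0// mul1r lerD2r ler_pM2l ?relA_gt0//.
exact: M12_le.
Qed.

Lemma rho_gt0 : 0 < rho P.
Proof. exact: lt_le_trans ltr01 rho_ge1. Qed.

Lemma rho_le_lambda1 : rho P <= lambda1 P.
Proof.
rewrite ler_pdivrMr ?chi_gt0//.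
have l1M : lambda1 P * normS (M1 P - M2 P) = normS (M1 P) + normS (M2 P).
  by rewrite divfK// gt_eqF ?M12_gt0.
have l1_ge1 : 1 <= lambda1 P.
  by rewrite ler_pdivlMr ?M12_gt0// mul1r; exact: M12_le.
rewrite mulrDr /chiA mulrCA l1M lerD2l ler_peMl//.
exact/ltW/chib_gt0.
Qed.

(** [M1_le] replaces [normS M1] in [calB] by [normS (M1 - M2) + normS M2], which
leaves [chiA] and twice the product [lambda2 * chib]. *)
Lemma rho_le_lambda2 : rho P <= 2 * lambda2 P + 1.
Proof.
rewrite ler_pdivrMr ?chi_gt0//.
have l2_gt0 : 0 < lambda2 P.
  by rewrite divr_gt0 ?mulr_gt0 ?sclA_gt0 ?sclb_gt0 ?sol_gt0.
have l2M := chib_lambda2; have := mulr_gt0 l2_gt0 chiA_gt0.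
have := ler_wpM2l (ltW relA_gt0) M1_le.
rewrite /calB; move: l2M; rewrite !mulrDr -/(chiA P); nra.
Qed.

(** If [chiA] dominates the denominator of [rho], then replacing the denominator
by [2 * chiA] at most halves the quotient [calB / chiA = lambda1].  If [chib]
dominates, use [lambda2 * chib = relA * normS M2] with
[relA = normF sclA / norm2 sol]: the product [lambda2 * chiA] is at most this,
which accounts for the term of [M2] in [calB], and [M2_le] bounds the remaining
[lambda2 * chib] by [relA * normS M1 + chiA], hence by the rest of the
numerator. *)
Lemma lambda_le_rho : lambda1 P <= 2 * rho P \/ lambda2 P <= rho P.
Proof.
have [dom|dom] := leP (chib P) (chiA P); [left|right].
  rewrite /lambda1 ler_pdivrMr ?M12_gt0//.
  rewrite -(ler_pM2r chi_gt0) mulrAC -[2 * _ * _]mulrA rho_chi.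
  have := ler_wpM2l (ltW (addr_gt0 M1_gt0 M2_gt0)) dom.
  have := mulr_gt0 chib_gt0 M12_gt0.
  rewrite /calB /chiA; move: (_ / _) (chib P) => k c; nra.
have l2_gt0 : 0 < lambda2 P.
  by rewrite divr_gt0 ?mulr_gt0 ?sclA_gt0 ?sclb_gt0 ?sol_gt0.
rewrite ler_pdivlMr ?chi_gt0//.
have l2M := chib_lambda2; have := ler_wpM2l (ltW l2_gt0) (ltW dom).
have := ler_wpM2l (ltW relA_gt0) M2_le.
rewrite /calB; move: l2M; rewrite !mulrDr -/(chiA P); nra.
Qed.

Lemma bound_coeffE : bound_coeff P = calB P + chib P.
Proof.
rewrite /bound_coeff /calB /chib normS_M1// normS_M2//.
by field; rewrite gt_eqF ?sol_gt0.
Qed.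

Lemma bound_coeff_gt0 : 0 < bound_coeff P.
Proof.
by rewrite bound_coeffE -rho_chi mulr_gt0 ?chi_gt0 ?rho_gt0.
Qed.

Lemma normS_GAJ : normS (invG P *m A^T *m J) = normS (invG P *m A^T).
Proof. by rewrite normS_mul_signature//; exact: ils_sgJ. Qed.

Lemma chibE : chib P = norm2 (sclb P) / norm2 x * normS (invG P *m A^T *m J).
Proof.
by rewrite /chib normS_M2// normS_GAJ; field; rewrite gt_eqF ?sol_gt0.
Qed.

Lemma response_le dA db :
  norm2 (response P dA db) / norm2 x <= (chiA P + chib P) * pert_eps P dA db.
Proof.
rewrite ler_pdivrMr ?sol_gt0// responseE (le_trans (norm2D _ _))//.
rewrite (le_trans (lerD (norm2_mul _ _) (norm2_mul _ _)))// norm2_vecmx.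
rewrite chibE mulrAC mulrDl mulrDl /chiA; set E := pert_eps _ _ _.
have dA_le : normF dA <= E * normF (sclA P).
  by rewrite -ler_pdivrMr ?sclA_gt0// le_max lexx.
have db_le : norm2 db <= E * norm2 (sclb P).
  by rewrite -ler_pdivrMr ?sclb_gt0// le_max lexx orbT.
have cancelx (k s : R) : k / norm2 x * s * norm2 x * E = s * (E * k).
  by field; rewrite gt_eqF ?sol_gt0.
by rewrite !cancelx lerD// ler_wpM2l ?normS_ge0.
Qed.

Lemma overestimates_by_rho (f : R) : f <= rho P -> overestimates_by P f.
Proof.
move=> f_le; case: nzP => -[a0 b0 _] _.
have [C [delta [delta0 errC]]] := response_error ilsP a0 b0.
exists (rho P * (C / norm2 x)), delta; split => // dA db dx posG' min_dx E_le.
have := errC _ _ _ posG' min_dx E_le; set E := pert_eps P dA db => err.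
apply: (@le_trans _ _ (rho P * (norm2 dx / norm2 x))).
  by rewrite ler_wpM2r// divr_ge0 ?norm2_ge0.
rewrite bound_coeffE -rho_chi.
rewrite [leRHS](_ : _ = rho P *
  ((chiA P + chib P) * E + C * E ^+ 2 / norm2 x)); last by ring.
apply: ler_wpM2l; first exact/ltW/rho_gt0.
apply: le_trans _ (lerD (response_le dA db) (lexx _)).
rewrite -mulrDl ler_wpM2r ?invr_ge0 ?norm2_ge0//.
rewrite -{1}(subrKC (response P dA db) dx) (le_trans (norm2D _ _))// lerD2l.
exact: err.
Qed.

Lemma pert_epsZ (t : R) dA db : 0 <= t ->
  pert_eps P (t *: dA) (t *: db) = t * pert_eps P dA db.
Proof.
move=> t0; rewrite /pert_eps normFZ norm2Z ger0_norm// -!mulrA.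
by rewrite maxr_pMr.
Qed.

Lemma pert_eps_ge0 dA db : 0 <= pert_eps P dA db.
Proof. by rewrite le_max divr_ge0 ?normF_ge0. Qed.

(** Scaling a perturbation by [t] and letting [t] tend to 0 removes the terms of
second order. *)
Lemma overestimates_by_response (f : R) dA db : 0 <= f -> overestimates_by P f ->
  f * (norm2 (response P dA db) / norm2 x) <= bound_coeff P * pert_eps P dA db.
Proof.
move=> f0 [C [delta [delta0 estC]]]; case: nzP => -[a0 b0 _] _.
have [C' [delta' [delta'0 errC']]] := response_error ilsP a0 b0.
have [d d0 solv] := perturbed_solution ilsP dA db.
set E := pert_eps P dA db; have E0 : 0 <= E by exact: pert_eps_ge0.
set y := norm2 (response P dA db) / norm2 x.
pose K := `|C * E ^+ 2 + f * (C' * E ^+ 2 / norm2 x)| + 1.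
have K0 : 0 < K by rewrite ltr_wpDl.
apply/ler_addgt0Pr => e e0.
(* t is small enough for the perturbed problem, for both expansions, and for
   the second-order terms, which are at most K t after division by t. *)
pose t := Num.min (d / 2) (Num.min (delta / (E + 1))
  (Num.min (delta' / (E + 1)) (e / K))).
have E1_gt0 : 0 < E + 1 by rewrite ltr_wpDl.
have t0 : 0 < t by rewrite !lt_min !divr_gt0.
have small (D : R) : 0 < D -> t <= D / (E + 1) -> t * E <= D.
  move=> D0; rewrite ler_pdivlMr// => tD; rewrite (le_trans _ tD)//.
  by rewrite ler_wpM2l ?(ltW t0)// lerDl.
have : t <= t by []; rewrite {2}/t !le_min => /and4P[td tdelta tdelta' tK].
have [|dx [posG' min_dx]] := solv t.
  rewrite t0/= (le_lt_trans td)// ltr_pdivrMr// ltr_pMr//.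
  lra.
have epsE : pert_eps P (t *: dA) (t *: db) = t * E by rewrite pert_epsZ// ltW.
have := estC _ _ _ posG' min_dx; have := errC' _ _ _ posG' min_dx.
rewrite epsE => /(_ (small _ delta'0 tdelta')) err /(_ (small _ delta0 tdelta)) est.
rewrite responseZ in err.
have ty_le : t * y <= norm2 dx / norm2 x + C' * (t * E) ^+ 2 / norm2 x.
  rewrite /y mulrA -mulrDl ler_wpM2r ?invr_ge0 ?norm2_ge0//.
  rewrite -(gtr0_norm t0) -norm2Z gtr0_norm// -{1}(subKr dx (t *: response P dA db)).
  rewrite -[dx - (dx - _)]/(dx + - (dx - _)) (le_trans (norm2D _ _))// norm2N lerD2l.
  exact: err.
rewrite -(ler_pM2l t0).
have := ler_wpM2l f0 ty_le; rewrite mulrDr => fty.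
have K_le : t * (C * E ^+ 2 + f * (C' * E ^+ 2 / norm2 x)) <= e.
  apply: (@le_trans _ _ (t * K)); last by rewrite -ler_pdivlMr.
  by rewrite ler_wpM2l ?(ltW t0)// (le_trans (ler_norm _))// lerDl.
have := ler_wpM2l (ltW t0) K_le.
move: est fty; rewrite !exprMn.
move: (norm2 dx / _) => z.
have -> : C' * (t ^+ 2 * E ^+ 2) / norm2 x = t ^+ 2 * (C' * E ^+ 2 / norm2 x) by ring.
move: (C' * E ^+ 2 / norm2 x) (E ^+ 2) => w F; nra.
Qed.

(** Each of the two condition numbers is approached separately, by a perturbation
of [A] alone or of [b] alone; adding the two resulting inequalities costs the
factor 2. *)
Lemma overestimates_by_le_rho (f : R) : overestimates_by P f -> f <= 2 * rho P.
Proof.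
move=> est; have [f0|f0] := leP f 0.
  by rewrite (le_trans f0)// mulr_ge0// ltW ?rho_gt0.
have resp_le := fun dA db => overestimates_by_response dA db (ltW f0) est.
have bc0 := bound_coeff_gt0.
have chiA_le : f * chiA P <= bound_coeff P.
  have fa0 : 0 < f * (normF (sclA P) / norm2 x) by rewrite mulr_gt0 ?relA_gt0.
  rewrite /chiA mulrA mulrC -ler_pdivlMr//; apply: normS_le => v.
  have [X ->] := vecmx_surj v; rewrite norm2_vecmx => X1.
  rewrite ler_pdivlMr//; have := resp_le (normF (sclA P) *: X) 0.
  rewrite responseE mulmx0 addr0.
  have -> : vecmx (normF (sclA P) *: X) = normF (sclA P) *: vecmx X.
    by apply/colP => k; rewrite !mxE.
  rewrite -scalemxAr norm2Z gtr0_norm ?sclA_gt0//.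
  have -> : pert_eps P (normF (sclA P) *: X) 0 = normF X.
    rewrite /pert_eps normFZ norm2_0 mul0r gtr0_norm ?sclA_gt0//.
    by rewrite mulrC mulKf ?gt_eqF ?sclA_gt0// max_l ?normF_ge0.
  have bX : bound_coeff P * normF X <= bound_coeff P by rewrite ler_piMr// ltW.
  by move=> /le_trans/(_ bX); apply: le_trans; rewrite le_eqVlt; apply/orP; left;
     apply/eqP; ring.
have chib_le : f * chib P <= bound_coeff P.
  have fb0 : 0 < f * (norm2 (sclb P) / norm2 x).
    by rewrite mulr_gt0 ?divr_gt0 ?sclb_gt0 ?sol_gt0.
  rewrite chibE mulrA mulrC -ler_pdivlMr//; apply: normS_le => v v1.
  rewrite ler_pdivlMr//; have := resp_le 0 (norm2 (sclb P) *: v).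
  rewrite responseE (_ : vecmx 0 = 0); last by apply/colP => k; rewrite !mxE.
  rewrite mulmx0 add0r -scalemxAr norm2Z gtr0_norm ?sclb_gt0//.
  have -> : pert_eps P 0 (norm2 (sclb P) *: v) = norm2 v.
    rewrite /pert_eps norm2Z normF0 mul0r gtr0_norm ?sclb_gt0//.
    by rewrite mulrC mulKf ?gt_eqF ?sclb_gt0// max_r ?norm2_ge0.
  have bv : bound_coeff P * norm2 v <= bound_coeff P by rewrite ler_piMr// ltW.
  by move=> /le_trans/(_ bv); apply: le_trans; rewrite le_eqVlt; apply/orP; left;
     apply/eqP; ring.
rewrite -(ler_pM2r chi_gt0) -mulrA rho_chi -bound_coeffE; lra.
Qed.

End Overestimation.

(** * A problem violating one starred inequality *)

Section Nonvanishing.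
Variables (R : realType) (m n : nat) (P : ils_data R m n).
Hypothesis ilsP : ils_problem P.
Local Notation A := (matA P).
Local Notation x := (sol P).

(** By the normal equations for [M1], and since [G^-1 A^T J A] is the identity for
[M2].  So [M2] and [M1 - M2] never vanish when the solution does not. *)
Lemma M1_matA : M1 P *m vecmx A = 0.
Proof.
by rewrite /M1 tens_row_vecmx (mulmxA A^T) ils_normal_eq// mulmx0.
Qed.

Lemma M2_matA : M2 P *m vecmx A = x.
Proof.
rewrite /M2 row_tens_vecmx; have := gram_unit ilsP; rewrite /invG => unitG.
by rewrite -[RHS](mulKmx unitG) !mulmxA.
Qed.

Lemma no_term_vanishesI : sclA P != 0 -> sclb P != 0 -> x != 0 -> resid P != 0 ->
  no_term_vanishes P.
Proof.
move=> a0 b0 x0 r0; split; first by rewrite normF_eq0 !norm2_eq0.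
have invG0 : normS (invG P) != 0.
  apply/eqP => /normS_eq0 G0; move: x0.
  by rewrite -(mulKmx (gram_unit ilsP) x) -/(invG P) G0 mul0mx eqxx.
split; first by rewrite normS_M1// mulf_neq0// norm2_eq0.
  apply/eqP => /normS_eq0 M0; move: x0.
  by rewrite -M2_matA M0 mul0mx eqxx.
apply/eqP => /normS_eq0 M0.
have : (M1 P - M2 P) *m vecmx A = - x.
  by rewrite mulmxBl M1_matA M2_matA sub0r.
by rewrite M0 mul0mx => /esym/eqP; rewrite oppr_eq0 (negPf x0).
Qed.

End Nonvanishing.

Section Example.
Variable R : realType.

Let e0 : 'cV[R]_2 := delta_mx 0 0.
Let e1 : 'cV[R]_2 := delta_mx 1 0.

(** An ordinary least squares problem with solution 1 and residual [e1].  As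
only the scale factor for [A] depends on [a], [lambda1] is the same for all [a],
while [lambda2] is [a] for [a >= 0]. *)
Definition unit_example (a : R) : ils_data R 2 1 :=
  IlsData e0 1%:M (e0 + e1) 1%:M (a *: e0) e0.

Lemma unit_example_resid a : resid (unit_example a) = e1.
Proof. by rewrite /resid/= mulmx1 addrC addKr. Qed.

Lemma unit_example_gram a : (matA (unit_example a))^T *m sigJ (unit_example a) *m
  matA (unit_example a) = 1%:M.
Proof.
rewrite /= mulmx1 trmx_delta mul_delta_mx; apply/matrixP => i j.
by rewrite !ord1 !mxE.
Qed.

Lemma unit_example_problem a : ils_problem (unit_example a).
Proof.
have sg1 : signature_mx (1%:M : 'M[R]_2).
  split; last by move=> i; left; rewrite mxE eqxx.
  exact: scalar_mx_is_diag.
have pos1 : posdef ((matA (unit_example a))^T *m sigJ (unit_example a) *m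
    matA (unit_example a)).
  rewrite unit_example_gram; split; first exact: trmx1.
  by move=> v v0; rewrite mulmx1 -norm2_sqr exprn_gt0// norm2_gt0.
split => //; apply: normal_equations_argmin => //.
rewrite -/(resid _) unit_example_resid /= mulmx1 trmx_delta.
by rewrite mul_delta_mx_0.
Qed.

Lemma norm2_e0 : norm2 e0 = 1.
Proof.
by rewrite /norm2 big_ord_recl big_ord1 !mxE/= expr1n expr0n addr0 sqrtr1.
Qed.

Lemma unit_example_nonvanishing a : a != 0 -> no_term_vanishes (unit_example a).
Proof.
have e_neq0 (i : 'I_2) : delta_mx i 0 != 0 :> 'cV[R]_2.
  by apply/eqP => /matrixP/(_ i 0)/eqP; rewrite !mxE !eqxx oner_eq0.
move=> a0; apply: no_term_vanishesI; first exact: unit_example_problem.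
- by apply/eqP => /eqP; rewrite scaler_eq0 (negPf a0) (negPf (e_neq0 _)).
- exact: e_neq0.
- by apply/eqP => /matrixP/(_ 0 0)/eqP; rewrite !mxE eqxx mulr1n oner_eq0.
- by rewrite unit_example_resid e_neq0.
Qed.

Lemma unit_example_lambda2 a : 0 <= a -> lambda2 (unit_example a) = a.
Proof.
move=> a0; rewrite /lambda2/= normFZ -norm2E norm2_e0 ger0_norm//.
by rewrite norm2E /normF !big_ord1 mxE expr1n sqrtr1 divr1 !mulr1.
Qed.

Lemma unit_example_strict :
  exists a, 0 < a /\ ~ lambda2 (unit_example a) <= rho (unit_example a) + 2^-1.
Proof.
pose a := lambda1 (unit_example 0) + 1.
have a0 : 0 < a by rewrite ltr_wpDl// divr_ge0 ?addr_ge0 ?normS_ge0.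
exists a; split => //; rewrite unit_example_lambda2 ?(ltW a0)//.
have := rho_le_lambda1 (unit_example_nonvanishing (lt0r_neq0 a0)).
have -> : lambda1 (unit_example a) = lambda1 (unit_example 0) by [].
by rewrite {2}/a; lra.
Qed.

End Example.

(** * Overestimation by the perturbation bound *)

Theorem theorem4p3 (R : realType) :
  (forall (m n : nat) (P : ils_data R m n),
     ils_problem P -> no_term_vanishes P ->
     [/\ rho P <= lambda1 P,
         rho P / 2 - 1 <= lambda2 P &
         lambda1 P <= 2 * rho P \/ lambda2 P <= rho P + 2^-1] /\
     perturbation_bound P /\
     (overestimates_by P (lambda1 P / 2) \/
      overestimates_by P (lambda2 P - 2^-1)))
  /\
  (exists (m n : nat) (P : ils_data R m n),
     [/\ ils_problem P, no_term_vanishes P &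
         ~ (lambda1 P <= 2 * rho P /\ lambda2 P <= rho P + 2^-1)])
  /\
  (* the bound is a uniformly large overestimate if lambda1, lambda2 >> 1 *)
  (forall f : R, exists L : R, forall (m n : nat) (P : ils_data R m n),
     ils_problem P -> no_term_vanishes P ->
     L <= lambda1 P -> L <= lambda2 P -> overestimates_by P f)
  /\
  (* ... and only if *)
  (forall L : R, exists f : R, forall (m n : nat) (P : ils_data R m n),
     ils_problem P -> no_term_vanishes P ->
     overestimates_by P f -> L <= lambda1 P /\ L <= lambda2 P).
Proof.
split=> [m n P ilsP nzP|].
  have nonneg_rho := rho_gt0 nzP.
  have rho2 := rho_le_lambda2 nzP.
  split; first split.
  - exact: rho_le_lambda1.
  - by rewrite lerBlDr ler_pdivrMr//; lra.
  - by case: (lambda_le_rho nzP) => [?|?]; [left|right; lra].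
  split; first exact/overestimates_by_rho/rho_ge1.
  by case: (lambda_le_rho nzP) => le; [left|right];
    apply: overestimates_by_rho => //; lra.
split.
  have [a [a_gt0 strict]] := unit_example_strict R.
  exists 2, 1, (unit_example a); split; first exact: unit_example_problem.
    by apply: unit_example_nonvanishing; rewrite gt_eqF.
  by case=> _; exact: strict.
split=> [f|L].
  exists (Num.max (2 * f) f) => m n P ilsP nzP; rewrite !ge_max.
  move=> /andP[f1 _] /andP[_ f2].
  by case: (lambda_le_rho nzP) => le; apply: overestimates_by_rho => //; lra.
(* From f <= 2 rho follow f / 2 <= lambda1 and f / 4 - 1 / 2 <= lambda2. *)
exists (Num.max (2 * L) (4 * L + 2)) => m n P ilsP nzP.
move=> /(overestimates_by_le_rho ilsP nzP); rewrite ge_max => /andP[f1 f2].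
have := rho_le_lambda1 nzP; have := rho_le_lambda2 nzP.
by move=> ? ?; split; lra.
Qed.
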